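(* There is an absolute constant $c>0$ such that for every integer $n\ge 5$ and every power $q$ of an odd prime there exists a center spherical Kakeya set $\mathcal{K}\subset\mathbb{F}_q^n$ with $$\left|\,|\mathcal{K}|-\left(\tfrac{1}{2}q^n + \tfrac{1}{2}q^{n-1}\right)\right|\le c\,q^{n-2}.$$
   Context: $\mathbb{F}_q$ is the finite field with $q$ elements and $\mathbb{F}_q^*=\mathbb{F}_q\setminus\{0\}$. For $\underline{x}=(x_1,\ldots,x_n)\in\mathbb{F}_q^n$ put $\|\underline{x}\|=x_1^2+\cdots+x_n^2\in\mathbb{F}_q$. The sphere of radius $r\in\mathbb{F}_q^*$ and center $\underline{a}\in\mathbb{F}_q^n$ is $\mathcal{S}_r(\underline{a})=\{\underline{x}\in\mathbb{F}_q^n : \|\underline{x}-\underline{a}\|=r\}$. A center spherical Kakeya set in $\mathbb{F}_q^n$ is a subset $\mathcal{K}\subset\mathbb{F}_q^n$ such that for each $a_1\in\mathbb{F}_q$ there are $r\in\mathbb{F}_q^*$ and a center $\underline{a}\in\mathbb{F}_q^n$ with first coordinate $a_1$ such that $\mathcal{S}_r(\underline{a})\subset\mathcal{K}$. *)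

(* Defs.v *)
From HB Require Import structures.
From mathcomp Require Import all_boot all_order all_algebra.

Set Implicit Arguments.
Unset Strict Implicit.
Unset Printing Implicit Defensive.

Import GRing.Theory.
Local Open Scope ring_scope.

Definition sqnorm (F : finFieldType) (n : nat) (x : 'rV[F]_n) : F :=
  \sum_(i < n) x 0 i ^+ 2.

Definition sphere (F : finFieldType) (n : nat) (r : F) (a : 'rV[F]_n) :
    {set 'rV[F]_n} :=
  [set x | sqnorm (x - a) == r].

(* The first coordinate of a is its entry at the index of value 0; writing it
   this way keeps the dimension an arbitrary n instead of n.+1. *)
Definition center_spherical_kakeya (F : finFieldType) (n : nat)
    (K : {set 'rV[F]_n}) : Prop :=
  forall a1 : F, exists (r : F) (a : 'rV[F]_n),
    [/\ r != 0,
        exists2 i : 'I_n, i = 0%N :> nat & a 0 i = a1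
      & sphere r a \subset K].

(* Main.v *)
(* The set consists of the x such that 1 - (x_2^2 + ... + x_n^2) is a square;
   it is the union of the unit spheres centred on the first axis.  A value v has
   2 [v is a square] - [v = 0] square roots, so 2 |K| = q (N_n(1) + N_{n-1}(1)),
   where N_m(v) counts the points of the sphere of radius v in dimension m.
   All circles of nonzero radius have the same cardinality N, and counting the
   circle of radius 0 gives |q - N| <= 1.  Adding two more coordinates yields
   N_4(v) exactly, one more coordinate gives |N_5(v) - q^4| <= q^2, and each
   further coordinate multiplies the error by at most q. *)
Require Import Defs.
From mathcomp Require Import all_boot all_order all_algebra.
From mathcomp Require Import fingroup cyclic.
From mathcomp Require Import ring lra.
From mathcomp Require Import reals.

Set Implicit Arguments.
Unset Strict Implicit.
Unset Printing Implicit Defensive.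

Import Order.TTheory GRing.Theory Num.Theory.
Local Open Scope ring_scope.

(** * Square roots in a finite field of odd order *)

Lemma odd_card_two_neq0 (F : finFieldType) : odd #|F| -> (2%:R : F) != 0.
Proof.
move=> oddF; apply/eqP => two0.
(* The order of the additive group annihilates 1; if 2 = 0, an odd multiple of 1 would still be
   1. *)
have : (1 : F) *+ #|F| = 0.
  have := expg_cardG (in_setT (1 : F)).
  by rewrite FinRing.zmodXgE FinRing.zmod1gE cardsT.
rewrite -(odd_double_half #|F|) oddF mulrnDr -mul2n mulrnA two0 mul0rn addr0.
by move/eqP; rewrite oner_eq0.
Qed.

(** Counting the double root 0 twice makes every value have 0 or 2 roots, so solvability becomes a
    linear expression in root counts and can be summed. *)
Lemma card_sqrt (F : finFieldType) (v : F) : (2%:R : F) != 0 ->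
  (#|[set s : F | (s ^+ 2 == v)%R]| + (v == 0%R) =
    2 * [exists s : F, s ^+ 2 == v])%N.
Proof.
move=> two_neq0; case: existsP => [[s /eqP <-]|no_sqrt].
  have -> : [set t : F | t ^+ 2 == s ^+ 2] = [set s; - s].
    by apply/setP => t; rewrite !inE eqf_sqr.
  rewrite cards2 sqrf_eq0.
  have -> : (s != - s) = (s != 0).
    by rewrite -subr_eq0 opprK -mulr2n -mulr_natl mulf_eq0 (negPf two_neq0).
  by case: eqP.
rewrite (_ : [set s : F | s ^+ 2 == v] = set0) ?cards0; last first.
  by apply/setP => s; rewrite !inE; apply/negP => ?; apply: no_sqrt; exists s.
by case: eqP no_sqrt => // -> []; exists 0; rewrite expr0n.
Qed.

Lemma card_set_sum (T : finType) (P : pred T) :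
  #|[set x | P x]| = (\sum_x P x)%N.
Proof.
rewrite cardsE -sum1_card big_mkcond; apply: eq_bigr => x _.
by rewrite unfold_in; case: (P x).
Qed.

Lemma card_fibers (aT rT : finType) (f : aT -> rT) :
  (\sum_v #|[set x | f x == v]| = #|aT|)%N.
Proof.
rewrite -[RHS]sum1_card (partition_big f predT) //=.
by apply: eq_bigr => v _; rewrite -sum1_card; apply: eq_bigl => x; rewrite inE.
Qed.

(** Sum [card_sqrt] over all v: the fibers of squaring partition F, and v = 0 contributes the extra
    1. *)
Lemma card_squares (F : finFieldType) : (2%:R : F) != 0 ->
  (2 * #|[set v : F | [exists s : F, (s ^+ 2 == v)%R]]| = #|F|.+1)%N.
Proof.
move=> two_neq0; rewrite -sum1_card big_mkcond big_distrr /=.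
transitivity (\sum_(v : F) (#|[set s : F | (s ^+ 2 == v)%R]| + (v == 0%R)))%N.
  by apply: eq_bigr => v _; rewrite card_sqrt // inE; case: [exists s, _].
rewrite big_split /= card_fibers -addn1; congr addn.
by rewrite (bigD1 0) //= eqxx big1 // => v /negPf->.
Qed.

(* Pigeonhole: [v - squares] and [squares] both have [(q + 1) / 2] elements. *)
Lemma sum_two_squares (F : finFieldType) (v : F) : (2%:R : F) != 0 ->
  exists a b : F, a ^+ 2 + b ^+ 2 = v.
Proof.
move=> two_neq0; set S := [set v : F | [exists s : F, s ^+ 2 == v]].
have injv : injective (fun u : F => v - u) by move=> x y /addrI/oppr_inj.
have: S :&: ((fun u => v - u) @: S) != set0.
  apply/negP => /eqP dis.
  have := max_card [pred x in S :|: ((fun u => v - u) @: S)].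
  rewrite cardsU dis cards0 subn0 card_imset // addnn -mul2n card_squares //.
  by rewrite ltnn.
case/set0Pn => u; rewrite !inE => /andP[/existsP[a /eqP Ea] /imsetP[w]].
rewrite inE => /existsP[b /eqP Eb] Eu.
by exists a, b; rewrite Ea Eb Eu subrK.
Qed.

(** * Points on circles in the plane *)

Definition circle (F : finFieldType) (v : F) : {set F * F} :=
  [set z | z.1 ^+ 2 + z.2 ^+ 2 == v].

(* Multiplication by [a + b i] with norm [v] maps norm 1 onto norm [v]. *)
Lemma card_circle (F : finFieldType) (v : F) : (2%:R : F) != 0 -> v != 0 ->
  #|circle v| = #|circle (1 : F)|.
Proof.
move=> two_neq0 v_neq0; have [a [b Dv]] := sum_two_squares v two_neq0.
pose mul (z : F * F) := (a * z.1 - b * z.2, a * z.2 + b * z.1).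
pose div (z : F * F) :=
  ((a * z.1 + b * z.2) / v, (a * z.2 - b * z.1) / v).
have divK : cancel div mul.
  by case=> x y; rewrite /mul /div -Dv /=; congr pair; field; rewrite Dv.
have mulK : cancel mul div.
  by case=> x y; rewrite /mul /div -Dv /=; congr pair; field; rewrite Dv.
rewrite -[RHS](card_imset _ (can_inj mulK)); apply: eq_card => z.
rewrite -(divK z); case: (div z) => x y.
rewrite (mem_imset _ _ (can_inj mulK)) !inE /=.
have -> : (a * x - b * y) ^+ 2 + (a * y + b * x) ^+ 2 = v * (x ^+ 2 + y ^+ 2).
  by rewrite -Dv; ring.
by rewrite -[v in _ == v]mulr1 (inj_eq (mulfI v_neq0)).
Qed.

Lemma card_circle_total (F : finFieldType) : (2%:R : F) != 0 ->
  (#|circle (0%R : F)| + #|F|.-1 * #|circle (1%R : F)| = #|F| ^ 2)%N.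
Proof.
move=> two_neq0; rewrite -mulnn -card_prod.
rewrite -(card_fibers (fun z : F * F => z.1 ^+ 2 + z.2 ^+ 2)).
rewrite (bigD1 0) //=; congr addn.
rewrite (eq_bigr (fun=> #|circle (1 : F)|)) => [|v]; last first.
  exact: card_circle.
by rewrite sum_nat_const cardC1.
Qed.

Lemma card_circle_sum (F : finFieldType) (v : F) :
  #|circle v| = (\sum_(y : F) #|[set x : F | (x ^+ 2 == v - y ^+ 2)%R]|)%N.
Proof.
rewrite card_set_sum.
rewrite -(pair_bigA _ (fun x y : F => (x ^+ 2 + y ^+ 2 == v) : nat)).
rewrite exchange_big; apply: eq_bigr => y _; rewrite card_set_sum.
by apply: eq_bigr => x _ /=; rewrite eq_sym -subr_eq eq_sym.
Qed.

Lemma card_circle0 (F : finFieldType) : (2%:R : F) != 0 ->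
  (0 < #|circle (0%R : F)| < #|F|.*2)%N.
Proof.
move=> two_neq0; apply/andP; split.
  by apply/card_gt0P; exists (0, 0); rewrite inE /= expr0n addr0.
have fiber_le v : (#|[set x : F | (x ^+ 2 == v)%R]| + (v == 0%R) <= 2)%N.
  by rewrite card_sqrt //; case: [exists s, _].
rewrite card_circle_sum -addn1.
(* The extra indicator stands for the missing second root at y = 0; it is what makes the upper bound
   strict. *)
apply: (@leq_trans
    (\sum_(y : F) (#|[set x : F | (x ^+ 2 == 0 - y ^+ 2)%R]| + (y == 0%R)))%N).
  rewrite big_split /= leq_add2l (bigD1 0) //= eqxx; exact: leq_addr.
rewrite -muln2 -sum_nat_const; apply: leq_sum => y _.
by have := fiber_le (0 - y ^+ 2); rewrite sub0r oppr_eq0 sqrf_eq0.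
Qed.

(** * Slicing spheres along the first coordinate *)

Lemma big_rV_recl (F : finFieldType) (m : nat) (f : 'rV[F]_m.+1 -> nat) :
  (\sum_x f x = \sum_(s : F) \sum_(y : 'rV[F]_m) f (row_mx s%:M y))%N.
Proof.
rewrite pair_bigA /=.
rewrite (reindex (fun z : F * 'rV[F]_m => row_mx z.1%:M z.2 : 'rV[F]_m.+1)) //=.
exists (fun x : 'rV[F]_(1 + m) => (lsubmx x 0 0, rsubmx x)) => [[s y]|x] _ /=.
  by rewrite row_mxKl row_mxKr mxE eqxx mulr1n.
by rewrite -mx11_scalar hsubmxK.
Qed.

Lemma sqnorm_row_mx (F : finFieldType) (m : nat) (s : F) (y : 'rV[F]_m) :
  sqnorm (row_mx s%:M y : 'rV[F]_m.+1) = s ^+ 2 + sqnorm y.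
Proof.
rewrite /sqnorm (@big_split_ord _ _ _ 1 m) /= big_ord1 (row_mxEl s%:M y).
by rewrite mxE eqxx mulr1n; congr (_ + _); apply: eq_bigr => i _; rewrite (row_mxEr s%:M y).
Qed.

Definition card_sphere (F : finFieldType) (m : nat) (v : F) : nat :=
  #|[set x : 'rV[F]_m | sqnorm x == v]|.

Lemma card_sphereS (F : finFieldType) (m : nat) (v : F) :
  card_sphere m.+1 v = (\sum_(s : F) card_sphere m (v - s ^+ 2)%R)%N.
Proof.
rewrite /card_sphere card_set_sum big_rV_recl; apply: eq_bigr => s _.
rewrite card_set_sum; apply: eq_bigr => y _.
by rewrite sqnorm_row_mx addrC [in LHS]eq_sym -subr_eq eq_sym.
Qed.

Lemma card_sphere1 (F : finFieldType) (v : F) :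
  card_sphere 1 v = #|[set s : F | s ^+ 2 == v]|.
Proof.
rewrite /card_sphere !card_set_sum big_rV_recl; apply: eq_bigr => s _.
rewrite (big_pred1 0) => [|y]; last by rewrite [y]thinmx0 /= eqxx.
by rewrite sqnorm_row_mx [sqnorm 0]big_ord0 addr0.
Qed.

Lemma card_sphere2 (F : finFieldType) (v : F) :
  card_sphere 2 v = #|circle v|.
Proof.
rewrite card_sphereS card_circle_sum.
by apply: eq_bigr => s _; rewrite card_sphere1.
Qed.

(** * Sphere counts and their deviation from the mean *)

Section SphereEstimates.

Variables (R : realFieldType) (F : finFieldType).
Hypothesis two_neq0 : (2%:R : F) != 0.

Let q : R := #|F|%:R.
Let N : R := #|circle (1 : F)|%:R.

Let q_ge1 : 1 <= q.
Proof. by rewrite /q ler1n; apply/card_gt0P; exists 0. Qed.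

(** A constant plus a point mass at 0: adding two coordinates preserves this shape. *)
Lemma card_sphere2E (v : F) :
  (card_sphere 2 v)%:R = N + q * (q - N) * (v == 0)%:R :> R.
Proof.
rewrite card_sphere2; have [->|v_neq0] := eqVneq v 0; last first.
  by rewrite card_circle // mulr0 addr0.
have q_gt0 : (0 < #|F|)%N by apply/card_gt0P; exists 0.
have := congr1 (fun i => i%:R : R) (card_circle_total two_neq0).
rewrite natrD natrM natrX -subn1 natrB // -/N -/q => total.
rewrite mulr1; lra.
Qed.

(** With d = q - N, the circle of radius 0 has q + (q - 1) d points. By [card_circle0] this lies
    between 1 and 2q - 1, so d lies in [-1, 1]. Only the square of d enters the later counts. *)
Lemma circle_defect : (q - N) ^+ 2 <= 1.
Proof.
have q_gt1 : 1 < q.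
  rewrite /q ltr1n; apply/card_gt1P; exists 0, 1; split => //.
  by rewrite eq_sym oner_eq0.
have := card_sphere2E 0; rewrite eqxx mulr1 card_sphere2 => card0.
have /andP[] := card_circle0 two_neq0.
rewrite -(ler_nat R) card0 => lo.
rewrite -(ler_nat R) -natr1 card0 -addnn natrD -/q => hi.
have q1_gt0 : 0 < q - 1 by lra.
have defect_ge : -1 <= q - N by rewrite -(ler_pM2l q1_gt0); lra.
have defect_le : q - N <= 1 by rewrite -(ler_pM2l q1_gt0); lra.
nra.
Qed.

Lemma sum_sphere m (v : F) :
  (card_sphere m.+1 v)%:R = \sum_(s : F) (card_sphere m (v - s ^+ 2))%:R :> R.
Proof. by rewrite card_sphereS natr_sum. Qed.

Lemma card_sphere4E (v : F) :
  (card_sphere 4 v)%:R =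
    q ^+ 3 - q * (q - N) ^+ 2 + q ^+ 2 * (q - N) ^+ 2 * (v == 0)%:R :> R.
Proof.
(* Summing the point mass over two coordinates gives back a circle count, so [card_sphere2E] can be
   applied a second time. *)
have sum_delta (w : F) : \sum_(s : F) \sum_(t : F)
    (w - s ^+ 2 - t ^+ 2 == 0)%:R = (card_sphere 2 w)%:R :> R.
  rewrite sum_sphere; apply: eq_bigr => s _.
  rewrite card_sphere1 card_set_sum natr_sum; apply: eq_bigr => t _.
  by rewrite subr_eq0 eq_sym.
have -> : (card_sphere 4 v)%:R =
    q ^+ 2 * N + q * (q - N) * (card_sphere 2 v)%:R :> R.
  rewrite sum_sphere -sum_delta mulr_sumr.
  have -> : q ^+ 2 * N = \sum_(s : F) q * N.
    by rewrite sumr_const -[RHS]mulr_natl mulrA -expr2.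
  rewrite -big_split; apply: eq_bigr => s _ /=.
  rewrite sum_sphere mulr_sumr.
  have -> : q * N = \sum_(s : F) N by rewrite sumr_const -mulr_natl.
  by rewrite -big_split; apply: eq_bigr => t _; exact: card_sphere2E.
rewrite card_sphere2E; ring.
Qed.

Lemma card_sphere4_bound (v : F) :
  `|(card_sphere 4 v)%:R - q ^+ 3| <= q ^+ 2.
Proof.
rewrite card_sphere4E ler_norml; have := circle_defect; have := q_ge1.
have := sqr_ge0 (q - N); move: ((q - N) ^+ 2) => d d_ge0 q1 d_le1.
by case: (v == 0); rewrite ?mulr1 ?mulr0; nra.
Qed.

(** In the sum of [card_sphere4E] over s, the point mass is met once per square root of v, while the
    terms - q (q - N)^2 add up to - q^2 (q - N)^2. The deviation is thus q^2 (q - N)^2 times the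
    number of roots minus 1, a factor in [-1, 1]. *)
Lemma card_sphere5_bound (v : F) :
  `|(card_sphere 5 v)%:R - q ^+ 4| <= q ^+ 2.
Proof.
have -> : (card_sphere 5 v)%:R = q ^+ 4 +
    (q - N) ^+ 2 * q ^+ 2 * (#|[set s : F | s ^+ 2 == v]|%:R - 1) :> R.
  rewrite sum_sphere (eq_bigr _ (fun s _ => card_sphere4E _)) big_split /=.
  rewrite sumr_const -[_ *+ #|_|]mulr_natl -/q -mulr_sumr.
  have -> : \sum_(s : F) (v - s ^+ 2 == 0)%:R =
      #|[set s : F | s ^+ 2 == v]|%:R :> R.
    rewrite card_set_sum natr_sum; apply: eq_bigr => s _.
    by rewrite subr_eq0 eq_sym.
  by ring.
have : (#|[set s : F | s ^+ 2 == v]| <= 2)%N.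
  apply: leq_trans (leq_addr (v == 0) _) _.
  by rewrite card_sqrt //; case: [exists s, _].
rewrite addrC addKr -(ler_nat R) => hi.
rewrite normrM (ger0_norm (mulr_ge0 (sqr_ge0 _) (sqr_ge0 _))).
have d_le1 := circle_defect.
have root_le : `|#|[set s : F | s ^+ 2 == v]|%:R - 1| <= 1 :> R.
  by rewrite ler_norml; have := ler0n R #|[set s : F | s ^+ 2 == v]|; lra.
rewrite mulrAC -[leRHS]mul1r ler_wpM2r ?exprn_ge0 ?ler0n //.
by rewrite mulr_ile1 ?sqr_ge0.
Qed.

Lemma sphere_boundS m (C A : R) :
  (forall v : F, `|(card_sphere m v)%:R - A| <= C) ->
  forall v : F, `|(card_sphere m.+1 v)%:R - q * A| <= q * C.
Proof.
move=> boundm v; rewrite sum_sphere.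
have const B : q * B = \sum_(s : F) B by rewrite sumr_const -mulr_natl.
rewrite !const -sumrB; apply: le_trans (ler_norm_sum _ _ _) _.
by apply: ler_sum => s _; apply: boundm.
Qed.

Lemma card_sphere_bound_ge4 m (v : F) :
  `|(card_sphere (m + 4) v)%:R - q ^+ (m + 3)| <= q ^+ (m + 2).
Proof.
elim: m v => [|m IHm] v; first exact: card_sphere4_bound.
by rewrite !addSn !exprS; apply: sphere_boundS.
Qed.

(** Starting the induction in dimension 5 saves a factor q over [card_sphere_bound_ge4], so both
    terms of [card_axis_kakeya] get the error q^(m + 2). *)
Lemma card_sphere_bound_ge5 m (v : F) :
  `|(card_sphere (m + 5) v)%:R - q ^+ (m + 4)| <= q ^+ (m + 2).
Proof.
elim: m v => [|m IHm] v; first exact: card_sphere5_bound.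
by rewrite !addSn !exprS; apply: sphere_boundS.
Qed.

End SphereEstimates.

(** * The union of unit spheres centred on the first axis *)

Lemma row_mx00 (F : finFieldType) (m : nat) (s : F) (y : 'rV[F]_m) :
  (row_mx s%:M y : 'rV[F]_m.+1) 0 0 = s.
Proof.
have -> : 0 = lshift m 0 :> 'I_(1 + m) by apply: val_inj.
by rewrite (row_mxEl s%:M y) mxE eqxx mulr1n.
Qed.

(** The witness s is the offset of the first coordinate of x from that of a centre on the axis; the
    first coordinate itself is unconstrained. *)
Definition axis_kakeya (F : finFieldType) (m : nat) : {set 'rV[F]_m.+1} :=
  [set x | [exists s : F, s ^+ 2 == 1 - (sqnorm x - x 0 0 ^+ 2)]].

(** The free first coordinate gives the factor [#|F|]. For a fixed tail y, [card_sqrt] at 1 -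
    [sqnorm y] splits into the roots, which complete y to a unit vector, and the indicator that y is
    one already. *)
Lemma card_axis_kakeya (F : finFieldType) (m : nat) : (2%:R : F) != 0 ->
  (2 * #|axis_kakeya F m| =
    #|F| * (card_sphere m.+1 (1%R : F) + card_sphere m (1%R : F)))%N.
Proof.
move=> two_neq0; rewrite /axis_kakeya card_set_sum big_rV_recl big_distrr /=.
rewrite -sum_nat_const; apply: eq_bigr => s _.
have -> : card_sphere m.+1 (1%R : F) =
    (\sum_(y : 'rV[F]_m) #|[set t : F | (t ^+ 2 == 1 - sqnorm y)%R]|)%N.
  rewrite /card_sphere card_set_sum big_rV_recl exchange_big.
  apply: eq_bigr => y _; rewrite card_set_sum; apply: eq_bigr => t _.
  by rewrite sqnorm_row_mx eq_sym -subr_eq eq_sym.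
rewrite {1}/card_sphere card_set_sum -big_split big_distrr.
apply: eq_bigr => y _ /=; rewrite sqnorm_row_mx row_mx00 addrAC subrr add0r.
by rewrite [sqnorm y == 1]eq_sym -(subr_eq0 1) card_sqrt.
Qed.

Lemma axis_kakeya_spherical (F : finFieldType) (m : nat) :
  center_spherical_kakeya (axis_kakeya F m).
Proof.
move=> a1; exists 1, (row_mx a1%:M 0 : 'rV[F]_(1 + m)).
split; [exact: oner_neq0 | by exists 0; rewrite ?row_mx00 |].
apply/subsetP => x.
have [s [y ->]] : exists s y, x = row_mx (s%:M : 'rV[F]_1) (y : 'rV[F]_m).
  by exists (lsubmx (x : 'rV[F]_(1 + m)) 0 0), (rsubmx (x : 'rV[F]_(1 + m)));
     rewrite -mx11_scalar hsubmxK.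
have shift : row_mx s%:M y - row_mx a1%:M 0 = row_mx (s - a1)%:M y
    :> 'rV[F]_(1 + m).
  by rewrite opp_row_mx add_row_mx -raddfB subr0.
rewrite !inE shift !sqnorm_row_mx row_mx00 => /eqP <-.
apply/existsP; exists (s - a1).
by rewrite [s ^+ 2 + _]addrC addrK addrK.
Qed.

Theorem mainTheorem3 (R : realType) :
  exists2 c : R, 0 < c &
    forall (n p k : nat) (F : finFieldType),
      (5 <= n)%N -> prime p -> odd p -> (0 < k)%N -> #|F| = (p ^ k)%N ->
      exists2 K : {set 'rV[F]_n}, center_spherical_kakeya K &
        let q : R := #|F|%:R in
        `| #|K|%:R - (1 / 2 * q ^+ n + 1 / 2 * q ^+ (n - 1)) |
          <= c * q ^+ (n - 2).
Proof.
(* The constant 1 suffices: the error is half the sum of two terms, each at most q times q^(n -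
   3). *)
exists 1 => // n p k F n_ge5 _ odd_p _ cardF.
have two_neq0 : (2%:R : F) != 0.
  by apply: odd_card_two_neq0; rewrite cardF oddX odd_p orbT.
have [m ->] : exists m, n = (m + 4).+1.
  by exists (n - 5)%N; rewrite -addnS subnK.
exists (axis_kakeya F (m + 4)); first exact: axis_kakeya_spherical.
move=> q; have q_ge0 : 0 <= q by exact: ler0n.
have := card_sphere_bound_ge5 R two_neq0 m 1.
have := card_sphere_bound_ge4 R two_neq0 m 1.
have := congr1 (fun i => i%:R : R) (card_axis_kakeya (m + 4) two_neq0).
rewrite natrM [(#|F| * _)%:R]natrM natrD -/q subn1 subn2 /= !addnS !addn0.
rewrite !exprS; set P := q * (q * q ^+ m).
move: (card_sphere _ _)%:R (card_sphere _ _)%:R #|_|%:R => S4 S5 K card_K.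
(* Here P is q^(m + 2), the common error of both sphere counts; the factor q comes from the free
   first coordinate. *)
have scale (x : R) : `|x| <= P -> - (q * P) <= q * x <= q * P.
  by rewrite ler_norml => /andP[lo hi]; rewrite -mulrN !ler_wpM2l.
move=> /scale/andP[lo4 hi4] /scale/andP[lo5 hi5].
by rewrite ler_norml; apply/andP; split; lra.
Qed.
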